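(* Let $F$ be a subfield of $\mathbb{C}$ that is invariant under complex conjugation, and let $R = F[t,t^{-1}]$. For $f = \sum_n a_n t^n \in R$ put $\overline{f} = \sum_n \overline{a_n}\, t^{-n}$. Suppose $f \in R$ is $u\, p_1^{e_1} p_2^{e_2}\cdots p_k^{e_k}$ where $u \in R$ is a unit and the $p_i \in R$ are pairwise non-associate irreducibles (and $e_i \ge 1$). Then $f$ is a norm if and only if for every $i$ either (1) $\overline{p_i}$ is an associate of $p_i$ and $e_i$ is even, or (2) $\overline{p_i}$ is an associate of some other $p_j$ (with $j \neq i$) and $e_i = e_j$.
   Context: An element $f \in R$ is a norm when there is a $g \in R$ with $f = u\, g\, \overline{g}$ for some unit $u$ of $R$. The units of $R$ are the elements $a t^n$ with $a \in F^\times$ and $n \in \mathbb{Z}$. *)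

(* Defs.v *)
From HB Require Import structures.
From mathcomp Require Import all_boot all_order all_algebra finmap.
From mathcomp Require Import boolp reals.
From mathcomp.real_closed Require Import complex.
From mathcomp.multinomials Require Import monalg.

Set Implicit Arguments.
Unset Strict Implicit.
Unset Printing Implicit Defensive.

Import GRing.Theory.
Local Open Scope ring_scope.
Local Open Scope complex_scope.

Section LaurentPolynomials.
Variable A : comNzRingType.
Implicit Types f g h : {malg A[int]}.

(* The family (f@_n)_n of coefficients of a Laurent polynomial f is a finitely
   supported function on int, and << a *g n >> is the monomial a t^n. The ring
   structure that monalg puts on {malg A[K]} does not apply to K := int: its
   monomType interface excludes monoids with nontrivial invertible elements. *)
Definition laurent : Type := {malg A[int]}.

Definition laurent1 : {malg A[int]} := << 1 *g 0%R >>.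

Definition laurent_mul f g : {malg A[int]} :=
  \sum_(m <- msupp f) \sum_(n <- msupp g) << f@_m * g@_n *g (m + n)%R >>.

Lemma laurent_mulw (d1 d2 : {fset int}) f g :
    (msupp f `<=` d1)%fset -> (msupp g `<=` d2)%fset ->
  laurent_mul f g =
    \sum_(m <- d1) \sum_(n <- d2) << f@_m * g@_n *g (m + n)%R >>.
Proof.
move=> le_d1 le_d2; rewrite /laurent_mul (big_fset_incl _ le_d1) /=.
  apply/eq_bigr=> m _; apply/big_fset_incl => // n _ /mcoeff_outdom ->.
  by rewrite mulr0 monalgU0.
move=> m _ /mcoeff_outdom fm.
by rewrite big1 => // n _; rewrite fm mul0r monalgU0.
Qed.

Lemma laurent_mulC : commutative laurent_mul.
Proof.
move=> f g; rewrite /laurent_mul exchange_big /=.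
by apply/eq_bigr=> n _; apply/eq_bigr=> m _; rewrite mulrC (addrC m).
Qed.

Lemma laurent_mulUU (a b : A) (m n : int) :
  laurent_mul << a *g m >> << b *g n >> = << a * b *g (m + n)%R >>.
Proof.
by rewrite (laurent_mulw msuppU_le msuppU_le) !big_seq_fset1 !mcoeffUU.
Qed.

Lemma laurent_mulDl : left_distributive laurent_mul +%R.
Proof.
move=> f g h.
rewrite (laurent_mulw (fsubsetUl (msupp f) (msupp g)) (fsubset_refl _)).
rewrite (laurent_mulw (fsubsetUr (msupp f) (msupp g)) (fsubset_refl _)).
rewrite (laurent_mulw (msuppD_le _ _) (fsubset_refl _)).
rewrite -big_split /=; apply/eq_bigr=> m _.
rewrite -big_split /=; apply/eq_bigr=> n _.
by rewrite mcoeffD mulrDl monalgUD.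
Qed.

Lemma laurent_mulDr : right_distributive laurent_mul +%R.
Proof. by move=> f g h; rewrite laurent_mulC laurent_mulDl !(laurent_mulC f). Qed.

Lemma laurent_mul0 g : laurent_mul 0 g = 0.
Proof. by rewrite /laurent_mul msupp0 big_seq_fset0. Qed.

Lemma laurent_mulr0 g : laurent_mul g 0 = 0.
Proof. by rewrite laurent_mulC laurent_mul0. Qed.

Lemma laurent_mulEl f g :
  laurent_mul f g = \sum_(m <- msupp f) laurent_mul << f@_m *g m >> g.
Proof.
apply/eq_bigr=> m _.
rewrite (laurent_mulw msuppU_le (fsubset_refl _)) big_seq_fset1.
by apply/eq_bigr=> n _; rewrite mcoeffUU.
Qed.

Lemma laurent_mulEr f g :
  laurent_mul f g = \sum_(n <- msupp g) laurent_mul f << g@_n *g n >>.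
Proof.
rewrite laurent_mulC laurent_mulEl.
by apply/eq_bigr=> n _; rewrite laurent_mulC.
Qed.

Lemma laurent_mulA : associative laurent_mul.
Proof.
move=> f g h.
rewrite [RHS](big_morph (laurent_mul^~ _)
  (fun _ _ => laurent_mulDl _ _ _) (laurent_mul0 _)).
rewrite laurent_mulEl; apply/eq_bigr=> m _.
rewrite [LHS](big_morph (laurent_mul _)
  (fun _ _ => laurent_mulDr _ _ _) (laurent_mulr0 _)).
rewrite [RHS](big_morph (laurent_mul^~ _)
  (fun _ _ => laurent_mulDl _ _ _) (laurent_mul0 _)).
apply/eq_bigr=> n _.
rewrite [LHS](big_morph (laurent_mul _)
  (fun _ _ => laurent_mulDr _ _ _) (laurent_mulr0 _)).
rewrite laurent_mulEr; apply/eq_bigr=> k _.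
by rewrite !laurent_mulUU mulrA addrA.
Qed.

Lemma laurent_mul1 : left_id laurent1 laurent_mul.
Proof.
move=> g; rewrite laurent_mulEr [RHS]monalgE.
by apply/eq_bigr=> n _; rewrite laurent_mulUU mul1r add0r.
Qed.

Lemma laurent1_neq0 : laurent1 != 0.
Proof. by rewrite monalgU_eq0 oner_eq0. Qed.

HB.instance Definition _ := GRing.Zmodule.copy laurent {malg A[int]}.
HB.instance Definition _ := GRing.Zmodule_isComNzRing.Build laurent
  laurent_mulA laurent_mulC laurent_mul1 laurent_mulDl laurent1_neq0.

(* The units are the invertible elements, decided classically. *)
Definition laurent_unit : {pred laurent} :=
  fun f => `[< exists g : laurent, g * f = 1 >].

Definition laurent_inv (f : laurent) : laurent :=
  if pselect (exists g : laurent, g * f == 1) is left fV then xchoose fV else f.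

Lemma laurent_unitPl (f g : laurent) : g * f = 1 -> f \in laurent_unit.
Proof. by move=> gf1; rewrite unfold_in; apply/asboolP; exists g. Qed.

Lemma laurent_mulV : {in laurent_unit, left_inverse 1 laurent_inv *%R}.
Proof.
move=> f; rewrite unfold_in => /asboolP f_unit; rewrite /laurent_inv.
case: pselect => [fV | []]; first by apply/eqP; apply: (xchooseP fV).
by have [g gf1] := f_unit; exists g; apply/eqP.
Qed.

Lemma laurent_inv_out : {in [predC laurent_unit], laurent_inv =1 id}.
Proof.
move=> f /negP fNunit; rewrite /laurent_inv.
case: pselect => // fV; case: fNunit; have [g /eqP gf1] := fV.
exact: laurent_unitPl gf1.
Qed.

HB.instance Definition _ := GRing.ComNzRing_hasMulInverse.Build laurent
  laurent_mulV laurent_unitPl laurent_inv_out.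

End LaurentPolynomials.

Section Divisibility.
Variable A : comUnitRingType.

Definition associate (x y : A) : Prop :=
  exists2 u : A, u \is a GRing.unit & x = u * y.

Definition irreducible_elt (x : A) : Prop :=
  [/\ x != 0, x \isn't a GRing.unit &
      forall y z : A, x = y * z -> y \is a GRing.unit \/ z \is a GRing.unit].

End Divisibility.

Section Conjugation.
Variables (R : realType) (S : {pred R[i]}) (F : subFieldType S).
Hypothesis conjS : forall z : R[i], z \in S -> z^* \in S.

Definition subfield_conj (x : F) : F := Sub (\val x)^* (conjS (valP x)).

Definition laurent_bar (f : laurent F) : laurent F :=
  \sum_(n <- msupp f) << subfield_conj f@_n *g (- n)%R >>.

Definition is_norm (f : laurent F) : Prop :=
  exists u g : laurent F,
    u \is a GRing.unit /\ f = u * g * laurent_bar g.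

End Conjugation.

(* Main.v *)
(* R = F[t, t^-1] is a localization of F[t], so it inherits Bezout's identity and
   irreducible elements are prime. If f = v g (bar g), unique factorization gives
   g ~ prod p_i^(a_i) and bar g ~ prod p_i^(b_i) with e_i = a_i + b_i. Each bar p_i
   is an irreducible divisor of f, so bar permutes the classes of the p_i by an
   involution s, and comparing bar g with bar (prod p_i^(a_i)) gives b_i = a_(s i).
   Hence e_i = a_i + a_(s i), which is even when s i = i and equals e_(s i) in
   general. Conversely, a solution of e_i = a_i + a_(s i) is obtained by halving
   e_i at the fixed points of s and giving all of e_i to the smaller index of each
   2-cycle. *)
Require Import Defs.
From HB Require Import structures.
From mathcomp Require Import all_boot all_order all_algebra finmap.
From mathcomp Require Import reals.
From mathcomp.real_closed Require Import complex.
From mathcomp.multinomials Require Import monalg.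
From mathcomp Require Import zify.

Set Implicit Arguments.
Unset Strict Implicit.
Unset Printing Implicit Defensive.

Import GRing.Theory.
Local Open Scope ring_scope.
Local Open Scope complex_scope.

(** * Associates, divisibility and irreducible elements in a commutative ring *)

Section Associates.
Variable A : comUnitRingType.
Implicit Types (x y z q : A).

Lemma associate_refl x : associate x x.
Proof. by exists 1; rewrite ?unitr1 ?mul1r. Qed.

Lemma associate_sym x y : associate x y -> associate y x.
Proof. by case=> u uU ->; exists u^-1; rewrite ?unitrV // mulKr. Qed.

Lemma associate_trans x y z : associate x y -> associate y z -> associate x z.
Proof.
case=> u uU -> [v vU ->].
by exists (u * v); rewrite ?unitrM ?uU // mulrA.
Qed.

Lemma associate_mul x x' y y' :
  associate x x' -> associate y y' -> associate (x * y) (x' * y').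
Proof.
case=> u uU -> [v vU ->].
by exists (u * v); rewrite ?unitrM ?uU // mulrACA.
Qed.

Lemma associate_unitl u x : u \is a GRing.unit -> associate (u * x) x.
Proof. by exists u. Qed.

Lemma associate_exp x y n : associate x y -> associate (x ^+ n) (y ^+ n).
Proof.
by case=> u uU ->; exists (u ^+ n); rewrite ?unitrX // exprMn.
Qed.

Lemma associate_prod (I : finType) (x y : I -> A) :
    (forall i, associate (x i) (y i)) ->
  associate (\prod_i x i) (\prod_i y i).
Proof.
move=> xy; elim/big_ind2: _ => [|? ? ? ?|i _]; last exact: xy.
  exact: associate_refl.
exact: associate_mul.
Qed.

Lemma associate_morph (f : {rmorphism A -> A}) x y :
  associate x y -> associate (f x) (f y).
Proof. by case=> u uU ->; exists (f u); rewrite ?rmorph_unit // rmorphM. Qed.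

Definition divides q x : Prop := exists z, x = z * q.

Lemma divides_unit q u : u \is a GRing.unit -> divides q u -> q \is a GRing.unit.
Proof. by move=> uU [z uE]; move: uU; rewrite uE unitrM => /andP[]. Qed.

Lemma irreducible_divides q r :
  irreducible_elt q -> irreducible_elt r -> divides q r -> associate q r.
Proof.
move=> [_ /negP qNU _] [_ _ r_irr] [z rE].
have [zU|//] := r_irr _ _ rE.
by rewrite rE; apply/associate_sym/associate_unitl.
Qed.

(** An involutive endomorphism is an automorphism, so it reflects units as well as preserving
    them. *)
Lemma irreducible_involution (f : {rmorphism A -> A}) q :
  involutive f -> irreducible_elt q -> irreducible_elt (f q).
Proof.
move=> fK [q_neq0 qNU q_irr].
have fU x : (f x \is a GRing.unit) = (x \is a GRing.unit).
  by apply/idP/idP=> /(rmorph_unit f); rewrite ?fK.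
split; rewrite ?fU //.
  by apply: contraNneq q_neq0 => fq0; rewrite -[q]fK fq0 rmorph0.
move=> x y /(congr1 f); rewrite fK rmorphM => /q_irr.
by rewrite !fU.
Qed.

End Associates.

(** * Factorization over a fixed family of primes in an integral domain with an involution *)

Section Factorization.
Variable D : idomainType.
Hypothesis irr_prime : forall q x y : D,
  irreducible_elt q -> divides q (x * y) -> divides q x \/ divides q y.
Variables (k : nat) (p : 'I_k -> D).
Hypothesis p_irr : forall i, irreducible_elt (p i).
Implicit Types (a b e : 'I_k -> nat) (x y q u v : D).

Lemma prod_incr a i :
  \prod_j p j ^+ (a j + (j == i)) = p i * \prod_j p j ^+ a j.
Proof.
under eq_bigr do rewrite exprD.
rewrite big_split /= mulrC; congr (_ * _).
rewrite (bigD1 i) //= eqxx expr1 big1 ?mulr1 // => j /negPf ->.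
by rewrite expr0.
Qed.

(** Extracts one factor [p i]. The boolean [j == i] acts as the indicator of [i], and positivity of
    [a i] keeps the truncated subtraction exact. *)
Lemma prod_decr a i : (0 < a i)%N ->
  \prod_j p j ^+ a j = p i * \prod_j p j ^+ (a j - (j == i)).
Proof.
move=> a_gt0; rewrite -prod_incr; apply/eq_bigr=> j _; congr (_ ^+ _).
by case: eqP => [->|_]; rewrite ?subn0 ?addn0 ?subnK.
Qed.

Lemma sum_decr a i : (0 < a i)%N ->
  (\sum_j a j = (\sum_j (a j - (j == i))).+1)%N.
Proof.
move=> a_gt0; rewrite (bigD1 i) //= [in RHS](bigD1 i) //= eqxx -addSn.
congr (_ + _)%N; first by lia.
by apply/eq_bigr=> j /negPf ->; rewrite subn0.
Qed.

Lemma sum_succ_pos a n : (\sum_j a j)%N = n.+1 -> exists i, (0 < a i)%N.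
Proof.
move=> aE; case: (pickP (fun i => 0 < a i)%N) => [i|a0]; first by exists i.
by move: aE; rewrite big1 // => j _; apply/eqP; rewrite eqn0Ngt a0.
Qed.

Lemma prod_expr0 a : (\sum_j a j)%N = 0%N -> \prod_j p j ^+ a j = 1.
Proof.
move/eqP; rewrite sum_nat_eq0 => /forallP a0.
by rewrite big1 // => j _; rewrite (eqP (a0 j)).
Qed.

Lemma factor_neq0 i : p i != 0.
Proof. by have [] := p_irr i. Qed.

(** A prime dividing the product divides one of its factors. Being a non-unit, it divides neither
    [u] nor a power with exponent zero. *)
Lemma irreducible_divides_prod q u a : irreducible_elt q ->
    u \is a GRing.unit -> divides q (u * \prod_i p i ^+ a i) ->
  exists2 i, (0 < a i)%N & associate q (p i).
Proof.
move=> q_irr uU; have [_ /negP qNU _] := q_irr.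
case/(irr_prime q_irr) => [/(divides_unit uU)//|].
elim/big_ind: _ => [/(divides_unit (unitr1 _))//|x y IHx IHy|i _].
  by case/(irr_prime q_irr) => [/IHx|/IHy].
case: (posnP (a i)) => [->|ai_gt0 q_dvd].
  by rewrite expr0 => /(divides_unit (unitr1 _)).
exists i => //; apply: irreducible_divides => //.
elim: (a i) q_dvd => [|n IHn]; first by move/(divides_unit (unitr1 _)).
by rewrite exprS => /(irr_prime q_irr) [].
Qed.

(** Induction on the total exponent: some [p i] is prime, hence divides [x] or [y]. It is cancelled
    there, and the exponent is credited to [a] or [b] accordingly. *)
Lemma factor_split e x y u : u \is a GRing.unit ->
    x * y = u * \prod_i p i ^+ e i ->
  exists a b, [/\ associate x (\prod_i p i ^+ a i),
    associate y (\prod_i p i ^+ b i) & forall i, e i = (a i + b i)%N].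
Proof.
move=> uU; move sum_e: (\sum_i e i)%N => n.
elim: n e sum_e x y => [|n IHn] e sum_e x y.
  move=> xyE; have e0 i : e i = 0%N.
    by move/eqP: sum_e; rewrite sum_nat_eq0 => /forallP/(_ i)/eqP.
  move: xyE; rewrite prod_expr0 // mulr1 => xyE.
  have := uU; rewrite -xyE unitrM => /andP[xU yU].
  exists (fun=> 0%N), (fun=> 0%N); rewrite !prod_expr0; try by rewrite big1.
  by split=> //; [exists x|exists y]; rewrite ?mulr1.
have [i ei_gt0] := sum_succ_pos sum_e.
rewrite (prod_decr ei_gt0) => xyE.
have sum_e' : (\sum_j (e j - (j == i)) = n)%N.
  by have := sum_decr ei_gt0; rewrite sum_e => -[].
have eE j : e j = (e j - (j == i) + (j == i))%N.
  by case: eqP => [->|_]; rewrite ?subn0 ?addn0 ?subnK.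
have : divides (p i) (x * y).
  by exists (u * \prod_j p j ^+ (e j - (j == i))); rewrite xyE mulrCA mulrC.
case/(irr_prime (p_irr i)) => -[z zE]; move: xyE; rewrite zE.
  rewrite -mulrA mulrCA [in RHS]mulrCA.
  move=> /(mulfI (factor_neq0 i)) /(IHn _ sum_e') [a [b [za yb eab]]].
  exists (fun j => a j + (j == i))%N, b; split=> // [|j].
    rewrite prod_incr [z * _]mulrC.
  exact: associate_mul (associate_refl _) _.
  by rewrite eE eab addnAC.
rewrite [LHS]mulrA [LHS]mulrC [RHS]mulrCA.
move=> /(mulfI (factor_neq0 i)) /(IHn _ sum_e') [a [b [xa zb eab]]].
exists a, (fun j => b j + (j == i))%N; split=> // [|j].
  rewrite prod_incr [z * _]mulrC.
  exact: associate_mul (associate_refl _) _.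
by rewrite eE eab addnA.
Qed.

Hypothesis p_nonassoc : forall i j, i != j -> ~ associate (p i) (p j).

Lemma associate_inj i j : associate (p i) (p j) -> i = j.
Proof. by move=> pij; apply/eqP/negPn/negP=> /p_nonassoc; apply. Qed.

(** Induction on the total exponent: a prime present on one side is present on the other, and one
    copy is cancelled from both. *)
Lemma factor_uniq a b :
  associate (\prod_i p i ^+ a i) (\prod_i p i ^+ b i) -> a =1 b.
Proof.
(* [p i] divides the right-hand product, so it is associate to some [p j] with [b' j] positive;
   non-associateness forces [j = i]. *)
have div_pos a' b' i : associate (\prod_i p i ^+ a' i) (\prod_i p i ^+ b' i) ->
    (0 < a' i)%N -> (0 < b' i)%N.
  move=> [u uU ab] /prod_decr ai.
  have : divides (p i) (u * \prod_i p i ^+ b' i).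
    by rewrite -ab ai mulrC; eexists.
  by case/(irreducible_divides_prod (p_irr i) uU) => j ? /associate_inj ->.
move sum_a: (\sum_i a i)%N => n; elim: n a b sum_a => [|n IHn] a b sum_a ab i.
  have ai0 : a i = 0%N.
    by move/eqP: sum_a; rewrite sum_nat_eq0 => /forallP/(_ i)/eqP.
  rewrite ai0; apply/esym/eqP; rewrite eqn0Ngt; apply/negP.
  by move/(div_pos _ _ _ (associate_sym ab)); rewrite ai0.
have [j aj_gt0] := sum_succ_pos sum_a.
have bj_gt0 := div_pos _ _ _ ab aj_gt0.
have sum_a' : (\sum_i (a i - (i == j)) = n)%N.
  by have := sum_decr aj_gt0; rewrite sum_a => -[].
have [u uU] := ab; rewrite (prod_decr aj_gt0) (prod_decr bj_gt0) mulrCA.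
move/(mulfI (factor_neq0 j)) => ab'.
have /(_ i) := IHn _ (fun i => b i - (i == j))%N sum_a' (ex_intro2 _ _ u uU ab').
(* At [j] both exponents are positive, so equality after subtracting one gives equality before. *)
by case: eqP => [->|_]; rewrite ?subn0 //; lia.
Qed.

Variable bar : {rmorphism D -> D}.
Hypothesis barK : involutive bar.
Variables (u : D) (e : 'I_k -> nat).
Hypotheses (u_unit : u \is a GRing.unit) (e_gt0 : forall i, (0 < e i)%N).

(** Reindexing the right-hand product by [s] turns its factor at [i] into [p (s i) ^+ a i], which is
    associate to the image of [p i ^+ a i]. *)
Lemma bar_prod (s : 'I_k -> 'I_k) a : involutive s ->
    (forall i, associate (bar (p i)) (p (s i))) ->
  associate (bar (\prod_i p i ^+ a i)) (\prod_i p i ^+ a (s i)).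
Proof.
move=> sK bar_p; rewrite rmorph_prod.
rewrite [in X in associate _ X](reindex_inj (inv_inj sK)) /=.
apply: associate_prod => i.
by rewrite rmorphXn sK; apply: associate_exp.
Qed.

(** Applying [bar] twice shows that [p i] is associate to [p (s (s i))], and distinct members of the
    family are not associate. *)
Lemma bar_perm_inv (s : 'I_k -> 'I_k) :
  (forall i, associate (bar (p i)) (p (s i))) -> involutive s.
Proof.
move=> bar_p i; apply/esym/associate_inj; rewrite -[p i]barK.
exact: associate_trans (associate_morph bar (bar_p i)) (bar_p (s i)).
Qed.

(** The criterion in abstract form: what it takes from Laurent polynomials is that irreducibles are
    prime and that [bar] is an involutive ring morphism. *)
Lemma normP :
  (exists v g, v \is a GRing.unit /\ u * \prod_i p i ^+ e i = v * g * bar g) <->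
  (forall i,
     (associate (bar (p i)) (p i) /\ ~~ odd (e i)) \/
     (exists j, [/\ j != i, associate (bar (p i)) (p j) & e i = e j])).
Proof.
split=> [[v [g [vU fE]]] i|bar_paired].
  have fE' : (v * g) * bar g = u * \prod_i p i ^+ e i by [].
  have [a [b [va gb eab]]] := factor_split u_unit fE'.
  have ga : associate g (\prod_i p i ^+ a i).
    exact: associate_trans (associate_sym (associate_unitl g vU)) va.
  (* Since [e j] is positive, [p j] divides [g] or [bar g]. Hence [bar (p j)] divides [bar g] or
     [g], both of which factor over the family. *)
  have /fin_all_exists[s sP] : forall j, exists l, associate (bar (p j)) (p l).
    move=> j; have barpj_irr := irreducible_involution barK (p_irr j).
    have bar_div c x : associate x (\prod_i p i ^+ c i) ->
        divides (bar (p j)) x -> exists l, associate (bar (p j)) (p l).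
      move=> [w wU ->] /(irreducible_divides_prod barpj_irr wU)[l _ pl].
      by exists l.
    have := e_gt0 j; rewrite eab addn_gt0 => /orP[aj_gt0|bj_gt0].
      apply: bar_div gb _; have [w _ ->] := ga.
      by rewrite (prod_decr aj_gt0) mulrCA rmorphM mulrC; eexists.
    apply: bar_div ga _; rewrite -[g]barK; have [w _ ->] := gb.
    by rewrite (prod_decr bj_gt0) mulrCA rmorphM mulrC; eexists.
  have sK := bar_perm_inv sP.
  (* Two factorizations of [bar g] are compared: the one from [factor_split], and the image under
     [bar] of that of [g]. *)
  have bas : b =1 a \o s.
    apply: factor_uniq; apply: associate_trans (associate_sym gb) _.
    exact: associate_trans (associate_morph bar ga) (bar_prod a sK sP).
  have eE j : e j = (a j + a (s j))%N by rewrite eab bas.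
  have [si|siN] := eqVneq (s i) i.
    by left; split; [rewrite -{2}si | rewrite eE si addnn odd_double].
  by right; exists (s i); split=> //; rewrite !eE sK addnC.
(* The two alternatives merge into one choice of partner [j]: alternative (1) takes [j = i], and
   under (2) the parity clause is vacuous. *)
have /fin_all_exists[s sP] : forall i, exists j,
    [/\ associate (bar (p i)) (p j), e j = e i & j = i -> ~~ odd (e i)].
  move=> i; case: (bar_paired i) => [[barpi ?]|[j [/eqP ji barpi ->]]].
    by exists i; split.
  by exists j; split.
have bar_p i : associate (bar (p i)) (p (s i)) by case: (sP i).
have es i : e (s i) = e i by case: (sP i).
have sK := bar_perm_inv bar_p.
(* Exponents of the witness [g]: half of [e i] at a fixed point of [s]; on a 2-cycle the smaller
   index takes everything. *)
pose a i := if s i == i then (e i)./2 else if (i < s i)%N then e i else 0%N.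
have aas i : (a i + a (s i))%N = e i.
  rewrite /a sK es [i == s i]eq_sym; case: eqP => [si|/eqP siN].
    have [_ _ /(_ si) e_even] := sP i.
    by rewrite addnn even_halfK.
  case: ltngtP => [||si]; rewrite ?addn0 //.
  by case/eqP: siN; apply/val_inj.
(* Only associateness to [g * bar g] has to be shown, since the unit [v] absorbs the discrepancy. *)
have [v vU fE] : associate (u * \prod_i p i ^+ e i)
    (\prod_i p i ^+ a i * bar (\prod_i p i ^+ a i)).
  apply: associate_trans (associate_unitl _ u_unit) _.
  under eq_bigr do rewrite -aas exprD; rewrite big_split /=.
  apply: associate_mul (associate_refl _) _.
  exact: associate_sym (bar_prod a sK bar_p).
by exists v, (\prod_i p i ^+ a i); split=> //; rewrite fE mulrA.
Qed.

End Factorization.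

(** * The embedding of polynomials into Laurent polynomials, and clearing of denominators *)

Section LaurentOfPoly.
Variable A : comNzRingType.
Implicit Types (a b : A) (q r : {poly A}) (f g : laurent A).

(** The monomial retyped in [laurent A], so that the ring structure declared there applies to it. *)
Definition lmono a (n : int) : laurent A := << a *g n >>.

Lemma lmonoM a b m n : lmono a m * lmono b n = lmono (a * b) (m + n).
Proof. exact: laurent_mulUU. Qed.

Lemma lmono_unit n : lmono 1 n \is a GRing.unit.
Proof.
by apply/unitrP; exists (lmono 1 (- n)); rewrite !lmonoM mulr1 addNr addrN.
Qed.

Lemma laurentE f : f = \sum_(n <- msupp f) lmono f@_n n.
Proof. exact: monalgE. Qed.

Lemma laurentP f g : (forall n, f@_n = g@_n) -> f = g.
Proof. by move=> fg; apply/malgP. Qed.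

Lemma lmono_coef a m n : (lmono a m)@_n = a *+ (m == n).
Proof. exact: mcoeffU. Qed.

Lemma laurent_coef_sum (I : Type) (s : seq I) (G : I -> laurent A) n :
  (\sum_(i <- s) G i)@_n = \sum_(i <- s) (G i)@_n.
Proof. exact: (raddf_sum (mcoeff n)). Qed.

Definition lconst a : laurent A := lmono a 0.

Lemma lconst_is_zmod_morphism : zmod_morphism lconst.
Proof. by move=> a b; apply: (monalgUB 0 a b). Qed.

Lemma lconst_is_monoid_morphism : monoid_morphism lconst.
Proof. by split=> // a b; rewrite /lconst lmonoM addr0. Qed.

HB.instance Definition _ :=
  GRing.isZmodMorphism.Build A (laurent A) lconst lconst_is_zmod_morphism.
HB.instance Definition _ :=
  GRing.isMonoidMorphism.Build A (laurent A) lconst lconst_is_monoid_morphism.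

Lemma commr_lmono : commr_rmorph lconst (lmono 1 1).
Proof. by move=> a; apply: mulrC. Qed.

(** The inclusion of A[t] in A[t, t^-1], obtained as evaluation at t, so that it is a ring morphism
    by construction. *)
Definition laurent_of_poly : {poly A} -> laurent A := horner_morph commr_lmono.

HB.instance Definition _ := GRing.RMorphism.on laurent_of_poly.

Lemma lmonoXn (n : nat) : lmono 1 1 ^+ n = lmono 1 n.
Proof. by elim: n => // n IHn; rewrite exprS IHn lmonoM mulr1 -intS. Qed.

Lemma laurent_of_polyX : laurent_of_poly 'X = lmono 1 1.
Proof. exact: horner_morphX. Qed.

Lemma laurent_of_polyC a : laurent_of_poly a%:P = lmono a 0.
Proof. exact: horner_morphC. Qed.

Lemma laurent_of_polyZXn a (n : nat) : laurent_of_poly (a *: 'X^n) = lmono a n.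
Proof.
rewrite -mul_polyC rmorphM rmorphXn /= laurent_of_polyC laurent_of_polyX.
by rewrite lmonoXn lmonoM mulr1 add0r.
Qed.

Lemma coef_laurent_of_poly q (n : nat) : (laurent_of_poly q)@_(n%:Z) = q`_n.
Proof.
rewrite -[in LHS](coefK q) -[RHS]/(q`_n) poly_def rmorph_sum laurent_coef_sum.
under eq_bigr do rewrite /= laurent_of_polyZXn lmono_coef eqz_nat.
rewrite -[in RHS](coefK q) coef_poly; case: ltnP => [n_lt|n_ge].
  rewrite (bigD1 (Ordinal n_lt)) //= eqxx mulr1n big1 ?addr0 // => i.
  by rewrite -val_eqE /= => /negPf ->.
rewrite big1 // => i _; case: eqP => // iE.
by move: n_ge; rewrite -iE leqNgt ltn_ord.
Qed.

Lemma laurent_of_poly_inj : injective laurent_of_poly.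
Proof. by move=> q r qr; apply/polyP=> i; rewrite -!coef_laurent_of_poly qr. Qed.

(** Clears negative exponents by a power of t, which is a unit; questions up to units thus pass to
    polynomials. *)
Lemma laurent_shift f :
  exists (n : nat) q, lmono 1 n * f = laurent_of_poly q.
Proof.
rewrite [f]laurentE; elim/big_ind: _ => [|f1 f2 [n1 [q1 fq1]] [n2 [q2 fq2]]|m _].
- by exists 0%N, 0; rewrite mulr0 rmorph0.
(* The sum of the two shifts serves both summands; each polynomial is multiplied by the other's
   shift. *)
- exists (n1 + n2)%N, ('X^n2 * q1 + 'X^n1 * q2).
  rewrite [laurent_of_poly _]rmorphD /= !rmorphM !rmorphXn /=.
  rewrite laurent_of_polyX !lmonoXn -fq1 -fq2.
  by rewrite mulrDr !mulrA !lmonoM mulr1 PoszD [(n2 : int) + n1]addrC.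
(* The exponent [m] plus its absolute value is nonnegative; the outer absolute value only casts it
   to [nat]. *)
exists `|m|%N, (f@_m *: 'X^(`|m + `|m|%N|)).
rewrite laurent_of_polyZXn lmonoM mul1r; congr lmono; lia.
Qed.

End LaurentOfPoly.

(** After shifting, this is integrality of the polynomial ring, transported by injectivity. The
    domain structure provides the cancellation used in the factorization arguments. *)
Lemma laurent_integral (A : idomainType) (f g : laurent A) :
  f * g = 0 -> (f == 0) || (g == 0).
Proof.
have [[n [q fq]] [m [r gr]]] := (laurent_shift f, laurent_shift g) => fg0.
have /eqP : q * r = 0.
  apply: laurent_of_poly_inj; rewrite rmorph0 rmorphM /= -fq -gr.
  by rewrite mulrACA fg0 mulr0.
rewrite mulf_eq0 => /orP[]/eqP q0; apply/orP; [left|right]; apply/eqP.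
  by apply: (mulrI (lmono_unit _ n)); rewrite fq q0 rmorph0 mulr0.
by apply: (mulrI (lmono_unit _ m)); rewrite gr q0 rmorph0 mulr0.
Qed.

HB.instance Definition _ (A : idomainType) :=
  GRing.ComUnitRing_isIntegral.Build (laurent A) (@laurent_integral A).

(** * Bezout's identity and primality of irreducible Laurent polynomials over a field *)

Section Primes.
Variable F : fieldType.
Implicit Types f g h : laurent F.

Lemma laurent_bezout f g :
  exists h, [/\ divides h f, divides h g & exists a b, h = a * f + b * g].
Proof.
have [[n [q fq]] [m [r gr]]] := (laurent_shift f, laurent_shift g).
(* The Bezout combination itself is used as gcd: it agrees with [gcdp q r] only up to a scalar,
   which does not affect divisibility. *)
pose d := (egcdp q r).1 * q + (egcdp q r).2 * r.
have divides_shift l (x : laurent F) s : lmono 1 l * x = laurent_of_poly s ->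
    d %| s -> divides (laurent_of_poly d) x.
  move=> xs /dvdpP[c sE]; exists ((lmono 1 l)^-1 * laurent_of_poly c).
  by rewrite -mulrA -rmorphM /= -sE -xs mulKr ?lmono_unit.
exists (laurent_of_poly d); split.
- by apply: divides_shift fq _; rewrite -(eqp_dvdl _ (egcdpE q r)) dvdp_gcdl.
- by apply: divides_shift gr _; rewrite -(eqp_dvdl _ (egcdpE q r)) dvdp_gcdr.
exists (laurent_of_poly (egcdp q r).1 * lmono 1 n).
exists (laurent_of_poly (egcdp q r).2 * lmono 1 m).
by rewrite rmorphD /= !rmorphM /= -!mulrA fq gr.
Qed.

(** Take [h], a gcd of [q] and [f], with [q = x * h]. If [x] is a unit, [q] is associate to [h] and
    divides [f]. Otherwise [h] is a unit, and multiplying its Bezout identity by [g] shows that [q]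
    divides [g]. *)
Lemma laurent_irreducible_prime q f g :
  irreducible_elt q -> divides q (f * g) -> divides q f \/ divides q g.
Proof.
move=> [_ _ q_irr] [c fg].
have [h [[x qE] [y fE] [a [b hE]]]] := laurent_bezout q f.
have [xU|hU] := q_irr _ _ qE.
  by left; exists (y * x^-1); rewrite qE mulrA mulrVK.
right; exists (h^-1 * (a * g + b * c)); apply: (mulrI hU).
rewrite mulrA mulVKr // {1}hE !mulrDl -!mulrA -fg [q * g]mulrC.
by rewrite [f * g]mulrC.
Qed.

End Primes.

(** * The bar involution as a ring morphism of Laurent polynomials *)

Section Bar.
Variables (R : realType) (S : {pred R[i]}) (F : subFieldType S).
Hypothesis conjS : forall z : R[i], z \in S -> z^* \in S.
Local Notation conj := (subfield_conj (F := F) conjS).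
Local Notation bar := (laurent_bar (F := F) conjS).
Implicit Types f g : laurent F.

Lemma val_subfield_conj (x : F) : \val (conj x) = (\val x)^*.
Proof. exact: SubK. Qed.

Lemma subfield_conj_is_zmod_morphism : zmod_morphism conj.
Proof.
move=> x y; apply: val_inj.
by rewrite val_subfield_conj !rmorphB /= !val_subfield_conj.
Qed.

Lemma subfield_conj_is_monoid_morphism : monoid_morphism conj.
Proof.
split=> [|x y]; apply: val_inj; rewrite val_subfield_conj.
  by rewrite !rmorph1.
by rewrite !rmorphM /= !val_subfield_conj.
Qed.

Lemma subfield_conjK : involutive conj.
Proof. by move=> x; apply: val_inj; rewrite !val_subfield_conj conjcK. Qed.

HB.instance Definition _ :=
  GRing.isZmodMorphism.Build F F conj subfield_conj_is_zmod_morphism.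
HB.instance Definition _ :=
  GRing.isMonoidMorphism.Build F F conj subfield_conj_is_monoid_morphism.

(** Negation of exponents is injective, so at most the term of index [- n] contributes; off the
    support both sides vanish. *)
Lemma coef_laurent_bar f n : (bar f)@_n = conj f@_(- n).
Proof.
rewrite /laurent_bar laurent_coef_sum.
under eq_bigr do rewrite lmono_coef eqr_oppLR.
have [nf|nf] := boolP (- n \in msupp f); last first.
  rewrite (mcoeff_outdom nf) rmorph0 big_seq big1 // => m mf.
  by case: eqP => // mE; rewrite -mE mf in nf.
rewrite (big_fsetD1 _ nf) /= eqxx mulr1n big_seq big1 ?addr0 // => m.
by rewrite !inE => /andP[/negPf ->].
Qed.

Lemma laurent_barK : involutive bar.
Proof.
by move=> f; apply: laurentP => n; rewrite !coef_laurent_bar opprK subfield_conjK.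
Qed.

Lemma laurent_bar_lmono a n : bar (lmono a n) = lmono (conj a) (- n).
Proof.
apply: laurentP => m; rewrite coef_laurent_bar !lmono_coef rmorphMn.
by rewrite -eqr_oppLR.
Qed.

Lemma laurent_bar_is_zmod_morphism : zmod_morphism bar.
Proof.
move=> f g; apply: laurentP => n; rewrite coef_laurent_bar.
have coefB (x y : laurent F) l : (x - y)@_l = x@_l - y@_l by exact: mcoeffB.
by rewrite !coefB !coef_laurent_bar rmorphB.
Qed.

HB.instance Definition _ := GRing.isZmodMorphism.Build (laurent F) (laurent F)
  bar laurent_bar_is_zmod_morphism.

(** By additivity, multiplicativity reduces to products of two monomials. *)
Lemma laurent_bar_is_monoid_morphism : monoid_morphism bar.
Proof.
split=> [|f g].
  by rewrite -[1]/(lmono 1 0) laurent_bar_lmono rmorph1 oppr0.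
rewrite [f]laurentE [g]laurentE mulr_suml !raddf_sum mulr_suml /=.
apply/eq_bigr=> m _; rewrite !mulr_sumr raddf_sum; apply/eq_bigr=> n _ /=.
by rewrite lmonoM !laurent_bar_lmono lmonoM rmorphM opprD.
Qed.

HB.instance Definition _ := GRing.isMonoidMorphism.Build (laurent F) (laurent F)
  bar laurent_bar_is_monoid_morphism.

End Bar.

Theorem proposition3p6 (R : realType) (S : {pred R[i]}) (F : subFieldType S)
    (conjS : forall z : R[i], z \in S -> z^* \in S)
    (f u : laurent F) (k : nat) (p : 'I_k -> laurent F) (e : 'I_k -> nat)
    (u_unit : u \is a GRing.unit)
    (p_irr : forall i, irreducible_elt (p i))
    (p_nonassoc : forall i j, i != j -> ~ associate (p i) (p j))
    (e_ge1 : forall i, (1 <= e i)%N)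
    (f_fact : f = u * \prod_(i < k) p i ^+ e i) :
  is_norm conjS f <->
  (forall i,
     (associate (laurent_bar conjS (p i)) (p i) /\ ~~ odd (e i)) \/
     (exists j, [/\ j != i, associate (laurent_bar conjS (p i)) (p j)
                  & e i = e j])).
Proof.
rewrite f_fact.
(* [is_norm] unfolds to the left side of [normP], and the morphism structure of the bar map is found
   by inference. *)
exact: (normP (@laurent_irreducible_prime F) p_irr p_nonassoc
  (laurent_barK conjS) u_unit e_ge1).
Qed.
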